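(* For any triangle $ABC$ and any point $X$, the orthocenter of the $X$-focal triangle of $ABC$ is the point $X$ itself.
   Context: An exparabola of a triangle $ABC$ in the Euclidean plane is a parabola that is tangent to the three sides (side lines) $BC$, $CA$, $AB$ of the triangle; equivalently, the exparabolas are the regular conics tangent to the three side lines and to the line at infinity. For a point $X$ one considers the three exparabolas of $ABC$ whose axes are incident with $X$; these exparabolas are not required to be real. The focus of a parabola is the intersection point of its two isotropic tangents (the tangents with directions $(1,\pm\mathrm{i})$), which for a real parabola is the usual focus; the axis is the line through the focus in the direction of the parabola's point at infinity. Given three different parabolas, their focal triangle is the triangle formed by their respective foci. If $X$ is an arbitrary point and the three exparabolas of $ABC$ have axes incident with $X$, their focal triangle is called the focal triangle of $ABC$ with respect to $X$, or the $X$-focal triangle of $ABC$. As in the definition of the focal triangle, the three exparabolas are understood to be pairwise different. *)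

(* Defs.v *)
From mathcomp Require Import all_boot all_order all_algebra.
From mathcomp Require Import complex.

Set Implicit Arguments.
Unset Strict Implicit.
Unset Printing Implicit Defensive.

Import Order.TTheory GRing.Theory Num.Theory.
Local Open Scope ring_scope.

Section Plane.
Variable K : fieldType.

(* Homogeneous coordinates: points are nonzero rows, lines are nonzero columns,
   both up to a nonzero factor; the last coordinate vanishes at infinity. *)
Definition affine_pt (p : 'rV[K]_2) : 'rV[K]_3 := row_mx p (1 : 'rV[K]_1).
Definition infinite_pt (d : 'rV[K]_2) : 'rV[K]_3 := row_mx d (0 : 'rV[K]_1).

Definition incident (p : 'rV[K]_3) (l : 'cV[K]_3) : Prop := p *m l = 0.

Definition line_through (p q : 'rV[K]_3) (l : 'cV[K]_3) : Prop :=
  [/\ l != 0, incident p l & incident q l].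

Definition line_at_infinity : 'cV[K]_3 := delta_mx ord_max 0.

Definition collinear (P Q S : 'rV[K]_2) : Prop :=
  exists l : 'cV[K]_3,
    line_through (affine_pt P) (affine_pt Q) l /\ incident (affine_pt S) l.

Definition is_triangle (P Q S : 'rV[K]_2) : Prop := ~ collinear P Q S.

(* Over the complex numbers this is the bilinear extension of the Euclidean
   scalar product, not the Hermitian one. *)
Definition orthogonal_vec (u v : 'rV[K]_2) : Prop := u *m v^T = 0.

Definition on_altitude (P Q S H : 'rV[K]_2) : Prop :=
  orthogonal_vec (H - P) (Q - S).

Definition is_orthocenter (P Q S H : 'rV[K]_2) : Prop :=
  [/\ on_altitude P Q S H, on_altitude Q S P H & on_altitude S P Q H].

(* The conic of equation p *m M *m p^T = 0. *)
Definition regular_conic (M : 'M[K]_3) : Prop := M^T = M /\ M \in unitmx.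

Definition same_conic (M N : 'M[K]_3) : Prop :=
  exists2 k : K, k != 0 & M = k *: N.

Definition on_conic (M : 'M[K]_3) (p : 'rV[K]_3) : Prop := p *m M *m p^T = 0.

(* The tangent at a point p of a regular conic is the polar line of p. *)
Definition tangent_at (M : 'M[K]_3) (p : 'rV[K]_3) (l : 'cV[K]_3) : Prop :=
  [/\ p != 0, on_conic M p & exists2 k : K, k != 0 & l = k *: (M *m p^T)].

Definition tangent (M : 'M[K]_3) (l : 'cV[K]_3) : Prop :=
  exists p : 'rV[K]_3, tangent_at M p l.

Definition tangent_join (M : 'M[K]_3) (p q : 'rV[K]_3) : Prop :=
  exists l : 'cV[K]_3, line_through p q l /\ tangent M l.

Definition parabola (M : 'M[K]_3) : Prop :=
  regular_conic M /\ tangent M line_at_infinity.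

Definition exparabola (A B C : 'rV[K]_2) (M : 'M[K]_3) : Prop :=
  [/\ parabola M,
      tangent_join M (affine_pt B) (affine_pt C),
      tangent_join M (affine_pt C) (affine_pt A)
    & tangent_join M (affine_pt A) (affine_pt B)].

End Plane.

Section Focal.
Variable R : rcfType.

Definition isotropic_dir (s : R[i]) : 'rV[R[i]]_2 :=
  \row_(j < 2) if j == 0 then 1 else s.

(* F is a finite point, so the two tangents here differ from the line at
   infinity, which also contains both isotropic points at infinity. *)
Definition is_focus (M : 'M[R[i]]_3) (F : 'rV[R[i]]_2) : Prop :=
  tangent_join M (affine_pt F) (infinite_pt (isotropic_dir 'i%C)) /\
  tangent_join M (affine_pt F) (infinite_pt (isotropic_dir (- 'i%C))).

Definition is_axis (M : 'M[R[i]]_3) (l : 'cV[R[i]]_3) : Prop :=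
  exists F d : 'rV[R[i]]_2,
    [/\ is_focus M F, d != 0, on_conic M (infinite_pt d)
      & line_through (affine_pt F) (infinite_pt d) l].

Definition axis_incident (M : 'M[R[i]]_3) (X : 'rV[R[i]]_2) : Prop :=
  exists2 l : 'cV[R[i]]_3, is_axis M l & incident (affine_pt X) l.

Definition focal_triangle (M1 M2 M3 : 'M[R[i]]_3) (F1 F2 F3 : 'rV[R[i]]_2) :
    Prop :=
  [/\ ~ same_conic M1 M2, ~ same_conic M2 M3 & ~ same_conic M3 M1] /\
  [/\ is_focus M1 F1, is_focus M2 F2 & is_focus M3 F3].

Definition to_complex (p : 'rV[R]_2) : 'rV[R[i]]_2 :=
  map_mx (real_complex R) p.

Definition exparabola_axis_through (A B C X : 'rV[R]_2) (M : 'M[R[i]]_3) :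
    Prop :=
  exparabola (to_complex A) (to_complex B) (to_complex C) M /\
  axis_incident M (to_complex X).

(* At most three exparabolas have their axis through X, so the pairwise
   different M1, M2, M3 below are all of them. *)
Definition X_focal_triangle (A B C X : 'rV[R]_2) (F1 F2 F3 : 'rV[R[i]]_2) :
    Prop :=
  exists M1 M2 M3 : 'M[R[i]]_3,
    [/\ exparabola_axis_through A B C X M1,
        exparabola_axis_through A B C X M2,
        exparabola_axis_through A B C X M3
      & focal_triangle M1 M2 M3 F1 F2 F3].

End Focal.

(* Main.v *)
(* In isotropic coordinates z = x + iy, z' = x - iy centred at the circumcentre,
   the circumcircle is z z' = rho. Let a, b, c be the z-coordinates of the
   vertices and m = abc. A parabola with contact direction (d, d') at infinity
   and focus (z, z') has the dual equation
   d p (z p + r) + d' q (z' q + r) + h p q = 0 in the line p z + q z' + r = 0.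
   Tangency to the three sides forces z z' = rho and rho d z = - d' m, and
   determines h. Substituted into the condition that the axis passes through
   X = (x, x'), this gives
   rho z^3 - rho x z^2 - m x' z + m rho = 0. The three foci are distinct roots of
   this cubic, so z1 + z2 + z3 = x: as the foci lie on a circle centred at the
   origin, X is their orthocenter. *)

Require Import Defs.
From mathcomp Require Import all_boot all_order all_algebra.
From mathcomp Require Import complex reals ring.
Set Implicit Arguments.
Unset Strict Implicit.
Unset Printing Implicit Defensive.
Import Order.TTheory GRing.Theory Num.Theory.
Local Open Scope ring_scope.

(** * Linear-combination certificates, and coordinates of points and lines *)

Section Coordinates.
Variable K : fieldType.
Implicit Types (A B C F O P Q S X d : 'rV[K]_2) (l : 'cV[K]_3) (M N : 'M[K]_3).

Lemma big_ord3 (F : 'I_3 -> K) : \sum_i F i = F 0 + F 1 + F ord_max.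
Proof.
rewrite !big_ord_recl big_ord0 addr0 addrA.
by congr (F _ + F _ + F _); apply: val_inj.
Qed.

(** Reduces an equality to a ring identity: a nonzero multiple of [x - y] is displayed as a
    combination of known vanishing differences. The coefficients passed to these three lemmas below
    are such certificates. *)
Lemma eq_lincomb1 k c1 {L1 R1 x y : K} : k != 0 -> L1 = R1 ->
  k * (x - y) = c1 * (L1 - R1) -> x = y.
Proof.
move=> k0 -> e; apply/eqP; rewrite -subr_eq0; apply/eqP/(mulfI k0).
by rewrite e subrr !mulr0.
Qed.

Lemma eq_lincomb2 k c1 c2 {L1 R1 L2 R2 x y : K} : k != 0 -> L1 = R1 -> L2 = R2 ->
  k * (x - y) = c1 * (L1 - R1) + c2 * (L2 - R2) -> x = y.
Proof.
move=> k0 e1 -> e; apply: (@eq_lincomb1 _ c1 _ _ _ _ k0 e1).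
by rewrite e subrr mulr0 addr0.
Qed.

Lemma eq_lincomb3 k c1 c2 c3 {L1 R1 L2 R2 L3 R3 x y : K} :
  k != 0 -> L1 = R1 -> L2 = R2 -> L3 = R3 ->
  k * (x - y) = c1 * (L1 - R1) + c2 * (L2 - R2) + c3 * (L3 - R3) -> x = y.
Proof.
move=> k0 e1 e2 -> e; apply: (@eq_lincomb2 _ c1 c2 _ _ _ _ _ _ k0 e1 e2).
by rewrite e subrr mulr0 addr0.
Qed.

Arguments eq_lincomb1 {k} c1 {L1 R1 x y}.
Arguments eq_lincomb2 {k} c1 c2 {L1 R1 L2 R2 x y}.
Arguments eq_lincomb3 {k} c1 c2 c3 {L1 R1 L2 R2 L3 R3 x y}.

Lemma cV3_eq0 l : l 0 0 = 0 -> l 1 0 = 0 -> l ord_max 0 = 0 -> l = 0.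
Proof.
move=> h0 h1 h2; apply/matrixP=> i j; rewrite ord1 mxE.
by case: i => [[|[|[|//]]] hi]; [rewrite -[RHS]h0 | rewrite -[RHS]h1 | rewrite -[RHS]h2];
  congr (l _ _); apply: val_inj.
Qed.

Lemma incident_affine P l :
  incident (affine_pt P) l <-> P 0 0 * l 0 0 + P 0 1 * l 1 0 + l ord_max 0 = 0.
Proof.
have -> : P 0 0 * l 0 0 + P 0 1 * l 1 0 + l ord_max 0 = (affine_pt P *m l) 0 0.
  rewrite mxE big_ord3 -[l ord_max 0 in LHS]mul1r.
  have -> : affine_pt P 0 0 = P 0 0.
    by rewrite -[RHS](row_mxEl P (1 : 'M_1)); congr (row_mx _ _ _ _); apply: val_inj.
  have -> : affine_pt P 0 1 = P 0 1.
    by rewrite -[RHS](row_mxEl P (1 : 'M_1)); congr (row_mx _ _ _ _); apply: val_inj.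
  have -> : affine_pt P 0 ord_max = 1; last by [].
  transitivity ((1 : 'M[K]_1) 0 0); last by rewrite mxE.
  by rewrite -[RHS](row_mxEr P (1 : 'M_1)); congr (row_mx _ _ _ _); apply: val_inj.
split=> [->|h]; first by rewrite mxE.
by apply/matrixP=> i j; rewrite !ord1 h mxE.
Qed.

Lemma infinite_ptE d :
  [/\ infinite_pt d 0 0 = d 0 0, infinite_pt d 0 1 = d 0 1
    & infinite_pt d 0 ord_max = 0].
Proof.
split.
- by rewrite -[RHS](row_mxEl d (0 : 'M_1)); congr (row_mx _ _ _ _); apply: val_inj.
- by rewrite -[RHS](row_mxEl d (0 : 'M_1)); congr (row_mx _ _ _ _); apply: val_inj.
transitivity ((0 : 'M[K]_1) 0 0); last by rewrite mxE.
by rewrite -[RHS](row_mxEr d (0 : 'M_1)); congr (row_mx _ _ _ _); apply: val_inj.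
Qed.

Lemma incident_infinite d l :
  incident (infinite_pt d) l -> d 0 0 * l 0 0 + d 0 1 * l 1 0 = 0.
Proof.
have [e0 e1 e2] := infinite_ptE d.
move/matrixP/(_ 0 0); rewrite !mxE big_ord3 e0 e1 e2 mul0r addr0.
exact.
Qed.

(** * The dual conic of a parabola *)

Lemma unitmx_ker0 N v : N \in unitmx -> N *m v = 0 -> v = 0 :> 'cV[K]_3.
Proof. by move=> uN Nv; rewrite -[v](mulKmx uN) Nv mulmx0. Qed.

(** The pole of a tangent is its contact point, so [invmx M] is the matrix of the dual conic. *)
Lemma tangent_dual M l :
  regular_conic M -> tangent M l -> l^T *m invmx M *m l = 0.
Proof.
case=> sM uM [p [_ pMp [k _ ->]]].
have -> : (k *: (M *m p^T))^T = k *: (p *m M).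
  by rewrite linearZ /= trmx_mul trmxK sM.
by rewrite -!scalemxAl -scalemxAr mulmxK // mulmxA pMp !scaler0.
Qed.

Lemma trmx_inv_sym M : M^T = M -> (invmx M)^T = invmx M.
Proof. by rewrite trmx_inv => ->. Qed.

Lemma regular_dual_sym M i j : regular_conic M -> invmx M i j = invmx M j i.
Proof. by case=> sM _; rewrite -{1}(trmx_inv_sym sM) mxE. Qed.

Lemma parabola_dual22 M : parabola M -> invmx M ord_max ord_max = 0.
Proof.
case=> rM /(tangent_dual rM) /matrixP/(_ 0 0); rewrite trmx_delta.
by rewrite -rowE -colE !mxE.
Qed.

Lemma parabola_tangent M l : parabola M -> tangent M l ->
  let N := invmx M in let u := l 0 0 in let v := l 1 0 in let w := l ord_max 0 in
  N 0 0 * u ^+ 2 + N 1 1 * v ^+ 2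
    + 2 * (N 0 1 * u * v + N 0 ord_max * u * w + N 1 ord_max * v * w) = 0.
Proof.
move=> pM tl; have [rM _] := pM; cbv zeta.
have /matrixP/(_ 0 0) := tangent_dual rM tl.
rewrite !mxE big_ord3 !mxE !big_ord3 !mxE (parabola_dual22 pM).
rewrite (regular_dual_sym 1 0 rM) (regular_dual_sym ord_max 0 rM).
rewrite (regular_dual_sym ord_max 1 rM) => e; rewrite -[RHS]e.
by ring.
Qed.

Lemma parabola_dual_ker M u v w : parabola M -> let N := invmx M in
  N 0 0 * u + N 0 1 * v + N 0 ord_max * w = 0 ->
  N 0 1 * u + N 1 1 * v + N 1 ord_max * w = 0 ->
  N 0 ord_max * u + N 1 ord_max * v = 0 ->
  [/\ u = 0, v = 0 & w = 0].
Proof.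
move=> pM N e0 e1 e2; have [rM _] := pM.
pose c : 'cV[K]_3 := \col_j if j == 0 then u else if j == 1 then v else w.
have Nc : N *m c = 0.
  apply: cV3_eq0; rewrite !mxE big_ord3 !mxE //=.
    by rewrite [N 1 0](regular_dual_sym 1 0 rM).
  rewrite [N ord_max 0](regular_dual_sym ord_max 0 rM).
  rewrite [N ord_max 1](regular_dual_sym ord_max 1 rM).
  by rewrite [N ord_max ord_max](parabola_dual22 pM) mul0r addr0.
have c0 : c = 0.
  by apply: unitmx_ker0 Nc; rewrite unitmx_inv; case: rM.
have cE j : c j 0 = 0 by rewrite c0 mxE.
by split; [have := cE 0 | have := cE 1 | have := cE ord_max]; rewrite mxE.
Qed.

(** * Isotropic tangents and foci *)

Section Isotropic.
Variable s : K.
Hypothesis s2 : s ^+ 2 = -1.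

(** The isotropic line through [F] is proportional to (-s, 1, s (F0 + s F1)). Substituting it in the
    dual equation and cancelling [l 1 0 ^+ 2] leaves an equation of degree one in the focus. *)
Lemma focus_line M F d : parabola M -> d 0 0 = 1 -> d 0 1 = s ->
    tangent_join M (affine_pt F) (infinite_pt d) ->
  let N := invmx M in
  N 0 0 - N 1 1 + 2 * s * N 0 1
    = 2 * (F 0 0 + s * F 0 1) * (N 0 ord_max + s * N 1 ord_max).
Proof.
move=> pM d0 d1 [l [[l0 /incident_affine Fl /incident_infinite dl] tl]] N.
have := parabola_tangent pM tl; cbv zeta; rewrite -/N.
move: dl; rewrite d0 d1 mul1r => /eqP; rewrite addr_eq0 => /eqP el0.
move: Fl => /eqP; rewrite addrC addr_eq0 => /eqP el2.
have l1 : l 1 0 != 0.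
  apply: contraNneq l0 => e1; apply/eqP/cV3_eq0; rewrite ?el2 ?el0 e1 //; ring.
rewrite el2 el0 => e.
by apply: (eq_lincomb1 (-1) (expf_neq0 2 l1) e); ring: s2.
Qed.

(** The contact point at infinity has direction ([N 0 ord_max], [N 1 ord_max]), so vanishing would
    mean contact at the isotropic point (1, s). The focus equation would then make the dual matrix
    singular. *)
Lemma focus_finite M z : parabola M -> let N := invmx M in
  N 0 0 - N 1 1 + 2 * s * N 0 1 = 2 * z * (N 0 ord_max + s * N 1 ord_max) ->
  N 0 ord_max + s * N 1 ord_max != 0.
Proof.
move=> pM N e; apply/eqP=> d0; move: e; rewrite d0 mulr0 => e.
have eg : N 0 ord_max = - (s * N 1 ord_max) by apply/eqP; rewrite -addr_eq0; apply/eqP.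
have ea : N 0 0 = N 1 1 - 2 * s * N 0 1.
  by apply: (eq_lincomb1 1 (oner_neq0 K) e); ring.
(* This kernel vector forces [N 1 ord_max = 0]; then [N 0 ord_max] vanishes too and (0, 0, 1) lies
   in the kernel. *)
have [] := @parabola_dual_ker M (- s * N 1 ord_max) (N 1 ord_max) (- (N 0 0 + s * N 0 1)) pM;
  rewrite -/N ?eg ?ea; try ring: s2.
move=> _ f0 _; move: eg; rewrite f0 mulr0 => g0.
have [] := @parabola_dual_ker M 0 0 1 pM; rewrite -/N ?g0 ?f0; try by ring.
by move=> _ _ /eqP; rewrite oner_eq0.
Qed.

(** The coordinate z centred at [O]; replacing [s] by [- s] gives z'. *)
Definition isotropic_coord (O P : 'rV[K]_2) : K :=
  (P 0 0 - O 0 0) + s * (P 0 1 - O 0 1).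
End Isotropic.

(** * Contact at infinity and the direction of the axis *)

Lemma contact_at_infinity M d : parabola M -> on_conic M (infinite_pt d) ->
  let N := invmx M in d 0 0 * N 1 ord_max = d 0 1 * N 0 ord_max.
Proof.
move=> pM + N; have [rM _] := pM; have [sM uM] := rM.
rewrite /on_conic -mulmxA; set t := M *m _ => dt; apply/eqP.
have et : (infinite_pt d)^T = N *m t by rewrite mulKmx.
have [d0 d1 d2] := infinite_ptE d.
have t0 : d 0 0 * t 0 0 + d 0 1 * t 1 0 = 0.
  exact: incident_infinite dt.
have tE j : infinite_pt d 0 j = N j 0 * t 0 0 + N j 1 * t 1 0 + N j ord_max * t ord_max 0.
  by move/matrixP/(_ j 0): et; rewrite mxE => ->; rewrite mxE big_ord3.
have := tE ord_max; rewrite d2 {3}/N (parabola_dual22 pM) mul0r addr0.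
rewrite {1 2}/N (regular_dual_sym ord_max 0 rM) (regular_dual_sym ord_max 1 rM) -/N => e.
(* Otherwise the polar [t] of [d] is the line at infinity, and [d], being the pole of [t], is the
   contact direction after all. *)
apply: contraT => ne; rewrite -subr_eq0 in ne.
have e0 : t 0 0 = 0.
  by apply: (eq_lincomb2 (N 1 ord_max) (d 0 1) ne t0 e); ring.
have e1 : t 1 0 = 0.
  by apply: (eq_lincomb2 (- N 0 ord_max) (- d 0 0) ne t0 e); ring.
move: ne; rewrite -d0 -d1 !tE e0 e1 !mulr0 !add0r => /eqP[]; ring.
Qed.

Lemma axis_direction M F d l X : parabola M -> d != 0 ->
  on_conic M (infinite_pt d) ->
  line_through (affine_pt F) (infinite_pt d) l -> incident (affine_pt X) l ->
  let N := invmx M in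
  (X 0 0 - F 0 0) * N 1 ord_max = (X 0 1 - F 0 1) * N 0 ord_max.
Proof.
move=> pM dn0 /(contact_at_infinity pM) cM [l0 /incident_affine Fl /incident_infinite dl].
move=> /incident_affine Xl N; move: cM; cbv zeta; rewrite -/N => cM.
have par : (X 0 0 - F 0 0) * l 0 0 + (X 0 1 - F 0 1) * l 1 0 = 0.
  by apply: (eq_lincomb2 1 (-1) (oner_neq0 K) Xl Fl); ring.
(* With both entries zero, [l] would be the line at infinity, which misses the finite point [F]. *)
have ll : (l 0 0 != 0) || (l 1 0 != 0).
  apply: contraNT l0; rewrite negb_or !negbK => /andP[/eqP e0 /eqP e1].
  apply/eqP/cV3_eq0 => //; move: Fl; by rewrite e0 e1 !mulr0 !add0r.
have dd : (d 0 0 != 0) || (d 0 1 != 0).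
  apply: contraNT dn0; rewrite negb_or !negbK => /andP[/eqP e0 /eqP e1].
  apply/eqP/matrixP=> i j; rewrite ord1 mxE.
  by case: j => [[|[|//]] hj]; [rewrite -[RHS]e0 | rewrite -[RHS]e1];
    congr (d _ _); apply: val_inj.
have Xd : (X 0 0 - F 0 0) * d 0 1 = (X 0 1 - F 0 1) * d 0 0.
  case/orP: ll => h.
    by apply: (eq_lincomb2 (d 0 1) (- (X 0 1 - F 0 1)) h par dl); ring.
  by apply: (eq_lincomb2 (- d 0 0) (X 0 0 - F 0 0) h par dl); ring.
case/orP: dd => h.
  by apply: (eq_lincomb2 (N 0 ord_max) (X 0 0 - F 0 0) h Xd cM); ring.
by apply: (eq_lincomb2 (N 1 ord_max) (X 0 1 - F 0 1) h Xd cM); ring.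
Qed.

(** Successive divided differences. The value [k3 = 0] is allowed, and is used below for a line
    meeting a circle. *)
Lemma cubic_vieta (k3 k2 k1 k0 x y z : K) :
  x != y -> y != z -> z != x ->
  k3 * x ^+ 3 + k2 * x ^+ 2 + k1 * x + k0 = 0 ->
  k3 * y ^+ 3 + k2 * y ^+ 2 + k1 * y + k0 = 0 ->
  k3 * z ^+ 3 + k2 * z ^+ 2 + k1 * z + k0 = 0 ->
  [/\ k2 = - k3 * (x + y + z), k1 = k3 * (x * y + y * z + z * x)
    & k0 = - k3 * (x * y * z)].
Proof.
rewrite -(subr_eq0 x) -(subr_eq0 y) -(subr_eq0 z) => xy yz zx ex ey ez.
have d1 : k3 * (x ^+ 2 + x * y + y ^+ 2) + k2 * (x + y) + k1 = 0.
  by apply: (eq_lincomb2 1 (-1) xy ex ey); ring.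
have d2 : k3 * (y ^+ 2 + y * z + z ^+ 2) + k2 * (y + z) + k1 = 0.
  by apply: (eq_lincomb2 1 (-1) yz ey ez); ring.
have e2 : k2 = - k3 * (x + y + z).
  by apply: (eq_lincomb2 1 (-1) zx d2 d1); ring.
have e1 : k1 = k3 * (x * y + y * z + z * x).
  by apply: (eq_lincomb2 1 (- (x + y)) (oner_neq0 K) d1 e2); ring.
split=> //.
apply: (eq_lincomb3 1 (- x ^+ 2) (- x) (oner_neq0 K) ex e2 e1); ring.
Qed.

(** * Lines and chords of a circle in isotropic coordinates *)

Section Centred.
Variables (s : K) (O : 'rV[K]_2).
Hypotheses (s2 : s ^+ 2 = -1) (two0 : 2 != 0 :> K).

Let s0 : s != 0.
Proof. by apply: contra_eq_neq s2 => ->; rewrite expr0n eq_sym oppr_eq0 oner_neq0. Qed.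

Let zc := isotropic_coord s O.
Let zc' := isotropic_coord (- s) O.
(* The line [lp l * z + lq l * z' + lr l = 0] is twice the line [l]. *)
Let lp l := l 0 0 - s * l 1 0.
Let lq l := l 0 0 + s * l 1 0.
Let lr l := 2 * (l ord_max 0 + l 0 0 * O 0 0 + l 1 0 * O 0 1).

Lemma isotropic_line P l : incident (affine_pt P) l ->
  zc P * lp l + zc' P * lq l + lr l = 0.
Proof.
move=> /incident_affine Pl; rewrite /zc /zc' /lp /lq /lr /isotropic_coord.
by apply: (eq_lincomb1 2 (oner_neq0 K) Pl); ring: s2.
Qed.

Lemma isotropic_line_eq0 l : lp l = 0 -> lq l = 0 -> lr l = 0 -> l = 0.
Proof.
move=> p0 q0 r0.
have u0 : l 0 0 = 0.
  by apply: (eq_lincomb2 1 1 two0 p0 q0); rewrite /lp /lq; ring.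
have v0 : l 1 0 = 0.
  by apply: (eq_lincomb2 (-1) 1 (mulf_neq0 two0 s0) p0 q0); rewrite /lp /lq; ring.
apply: cV3_eq0 => //; apply: (mulfI two0); rewrite mulr0 -[RHS]r0 /lr u0 v0.
by rewrite !mul0r !addr0.
Qed.

(** The symmetric sum is twice the scalar product, because [s ^+ 2 = -1]. *)
Lemma orthogonal_isotropic (u v : 'rV[K]_2) :
  (u 0 0 + s * u 0 1) * (v 0 0 - s * v 0 1)
    + (u 0 0 - s * u 0 1) * (v 0 0 + s * v 0 1) = 0 -> orthogonal_vec u v.
Proof.
move=> e; apply/matrixP=> i j; rewrite !ord1 !mxE !big_ord_recl big_ord0 !mxE addr0.
have -> : lift ord0 ord0 = 1 :> 'I_2 by apply: val_inj.
by apply: (eq_lincomb1 1 two0 e); ring: s2.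
Qed.

(** A chord of the circle z z' = rho through [P] and [Q] has coefficients in the ratio rho : zP zQ :
    - rho (zP + zQ), and these are put into the dual equation. The terms in [O] inside [h] come from
    moving the origin to [O]. *)
Lemma side_equation M F P Q (rho : K) : parabola M ->
    tangent_join M (affine_pt P) (affine_pt Q) ->
  let N := invmx M in
  let d := N 0 ord_max + s * N 1 ord_max in
  let d' := N 0 ord_max + - s * N 1 ord_max in
  let h := N 0 0 + N 1 1 - d * (O 0 0 - s * O 0 1) - d' * (O 0 0 + s * O 0 1) in
  N 0 0 - N 1 1 + 2 * s * N 0 1 = 2 * (F 0 0 + s * F 0 1) * d ->
  N 0 0 - N 1 1 + 2 * - s * N 0 1 = 2 * (F 0 0 + - s * F 0 1) * d' ->
  rho != 0 -> zc P * zc' P = rho -> zc Q * zc' Q = rho -> zc P != zc Q ->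
  d * rho * (zc F * rho - rho * (zc P + zc Q))
    + d' * (zc P * zc Q) * (zc' F * (zc P * zc Q) - rho * (zc P + zc Q))
    + h * rho * (zc P * zc Q) = 0.
Proof.
move=> pM [l [[l0 Pl Ql] tl]] N d d' h eF eF' rho0 eP eQ.
rewrite -subr_eq0 => PQ.
have tM := parabola_tangent pM tl; cbv zeta in tM; rewrite -/N in tM.
(* The focus equations rewrite the coefficients of the squares of [lp l] and [lq l] in the dual
   equation through the isotropic coordinates of [F]. *)
have tI : d * lp l * (zc F * lp l + lr l) + d' * lq l * (zc' F * lq l + lr l)
    + h * lp l * lq l = 0.
  apply: (eq_lincomb3 4 (- lp l ^+ 2) (- lq l ^+ 2) two0 tM eF eF').
  by rewrite /h /d /d' /zc /zc' /isotropic_coord /lp /lq /lr; ring: s2.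
have {Pl}hP := isotropic_line Pl; have {Ql}hQ := isotropic_line Ql.
have hq : rho * lq l = lp l * zc P * zc Q.
  apply: (eq_lincomb2 (- zc P * zc Q) (zc P * zc Q) PQ hP hQ).
  by ring: eP eQ.
have hr : lr l = - lp l * (zc P + zc Q).
  by apply: (eq_lincomb2 rho (- zc' P) rho0 hP hq); ring: eP.
have p0 : lp l != 0.
  apply: contraNneq l0 => p0; apply/eqP/isotropic_line_eq0 => //.
    by apply: (mulfI rho0); rewrite hq p0 !mul0r mulr0.
  by rewrite hr p0 oppr0 mul0r.
rewrite hr in tI.
by apply: (eq_lincomb1 (rho ^+ 2) (expf_neq0 2 p0) tI); ring: hq.
Qed.

End Centred.

(* The three side equations say that [bc], [ca], [ab] are the roots of one
   cubic. *)
Lemma tangent_sides_focus (rho a b c d d' h z z' : K) :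
  let side p q := d * rho * (z * rho - rho * (p + q))
    + d' * (p * q) * (z' * (p * q) - rho * (p + q)) + h * rho * (p * q) = 0 in
  rho != 0 -> a != 0 -> b != 0 -> c != 0 -> a != b -> b != c -> c != a ->
  d != 0 -> d' != 0 -> side b c -> side c a -> side a b ->
  [/\ rho * d * z = - d' * (a * b * c), z * z' = rho
    & h * (a * b * c) = d' * (a + b + c) * (a * b * c)
        + d * rho * (a * b + b * c + c * a)].
Proof.
move=> side rho0 a0 b0 c0 ab bc ca d0 d'0 ebc eca eab.
have bcca : b * c != c * a by rewrite [b * c]mulrC (inj_eq (mulfI c0)) eq_sym.
have caab : c * a != a * b by rewrite [c * a]mulrC (inj_eq (mulfI a0)) eq_sym.
have abbc : a * b != b * c by rewrite [a * b]mulrC (inj_eq (mulfI b0)) eq_sym.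
set m := a * b * c; have m0 : m != 0 by rewrite !mulf_neq0.
(* With t = pq the third vertex is m / t, so p + q = a + b + c - m / t. Multiplying the side
   equation by t gives the cubic in t with these coefficients. *)
pose k2 := h * rho - d' * rho * (a + b + c).
pose k1 := d * rho ^+ 2 * (z - (a + b + c)) + d' * rho * m.
have [||| e2 e1 e0] :=
    @cubic_vieta (d' * z') k2 k1 (d * rho ^+ 2 * m) _ _ _ bcca caab abbc.
- by apply: (eq_lincomb1 (b * c) (oner_neq0 K) ebc); rewrite /k1 /k2 /m; ring.
- by apply: (eq_lincomb1 (c * a) (oner_neq0 K) eca); rewrite /k1 /k2 /m; ring.
- by apply: (eq_lincomb1 (a * b) (oner_neq0 K) eab); rewrite /k1 /k2 /m; ring.
(* The three roots have product m^2, and their pairwise products add up to m (a + b + c). *)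
have v0 : d' * z' * m = - d * rho ^+ 2.
  by apply: (eq_lincomb1 1 m0 e0); rewrite /m; ring.
have zE : rho * d * z = - d' * m.
  by apply: (eq_lincomb2 1 (a + b + c) rho0 e1 v0); rewrite /k1 /m; ring.
split=> //.
  have k0 : d * d' * rho * m != 0 by rewrite !mulf_neq0.
  by apply: (eq_lincomb2 (d' * m * z') (- d' * m) k0 zE v0); ring.
by apply: (eq_lincomb2 m (- (a * b + b * c + c * a)) rho0 e2 v0); rewrite /k2 /m; ring.
Qed.

(** The last hypothesis says that X - F is parallel to the contact direction. The other two give the
    ratio d : d' and z' = rho / z, which eliminates all three. *)
Lemma axis_cubic (rho m d d' z z' x x' : K) : d' != 0 ->
  rho * d * z = - d' * m -> z * z' = rho -> (x - z) * d' = (x' - z') * d ->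
  rho * z ^+ 3 + - rho * x * z ^+ 2 + - m * x' * z + m * rho = 0.
Proof.
move=> d'0 zE zz ax.
by apply: (eq_lincomb3 (- z * (x' - z')) (- d' * m) (- rho * z ^+ 2) d'0 zE zz ax); ring.
Qed.

(** Symmetry and the zero corner leave five entries of the dual matrix to compare; inverting turns
    [k] into [k^-1]. *)
Lemma same_conic_dual M1 M2 (k : K) : parabola M1 -> parabola M2 -> k != 0 ->
  let N1 := invmx M1 in let N2 := invmx M2 in
  N1 0 0 = k * N2 0 0 -> N1 0 1 = k * N2 0 1 -> N1 1 1 = k * N2 1 1 ->
  N1 0 ord_max = k * N2 0 ord_max -> N1 1 ord_max = k * N2 1 ord_max ->
  same_conic M1 M2.
Proof.
move=> pM1 pM2 k0 N1 N2 e00 e01 e11 e02 e12.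
have [r1 _] := pM1; have [r2 _] := pM2.
have e22 : N1 ord_max ord_max = k * N2 ord_max ord_max.
  by rewrite /N1 /N2 !parabola_dual22 // mulr0.
have sym i j : N1 i j = k * N2 i j -> N1 j i = k * N2 j i.
  by rewrite /N1 /N2 (regular_dual_sym i j r1) (regular_dual_sym i j r2).
have NE : N1 = k *: N2.
  apply/matrixP=> i j; rewrite mxE.
  have ordE (x : 'I_3) : [\/ x = 0, x = 1 | x = ord_max].
    by case: x => [[|[|[|//]]] hx]; [apply: Or31 | apply: Or32 | apply: Or33]; apply: val_inj.
  by case: (ordE i) => ->; case: (ordE j) => ->; auto.
exists k^-1; first by rewrite invr_eq0.
rewrite -[M1]invmxK -/N1 NE invmxZ ?invmxK //.
by rewrite unitmxZ ?unitfE // unitmx_inv; case: r2.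
Qed.

(** * Exparabolas of a triangle inscribed in the circle *)

Section Exparabola.
Variables (s rho : K) (O A B C e e' : 'rV[K]_2).
Hypotheses (s2 : s ^+ 2 = -1) (two0 : 2 != 0 :> K) (rho0 : rho != 0).
Hypotheses (e0 : e 0 0 = 1) (e1 : e 0 1 = s).
Hypotheses (e'0 : e' 0 0 = 1) (e'1 : e' 0 1 = - s).

Let zc := isotropic_coord s O.
Let zc' := isotropic_coord (- s) O.
Let m := zc A * zc B * zc C.

Hypotheses (circA : zc A * zc' A = rho) (circB : zc B * zc' B = rho).
Hypotheses (circC : zc C * zc' C = rho).
Hypotheses (AB : zc A != zc B) (BC : zc B != zc C) (CA : zc C != zc A).

Let s0 : s != 0.
Proof. by apply: contra_eq_neq s2 => ->; rewrite expr0n eq_sym oppr_eq0 oner_neq0. Qed.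

Let s'2 : (- s) ^+ 2 = -1.
Proof. by rewrite sqrrN. Qed.

(** The counterpart of [is_focus] over a general field, with [e] and [e'] as the isotropic
    directions. *)
Definition focal M F :=
  tangent_join M (affine_pt F) (infinite_pt e) /\
  tangent_join M (affine_pt F) (infinite_pt e').

Lemma focal_eqs M F : parabola M -> focal M F ->
  let N := invmx M in
  let d := N 0 ord_max + s * N 1 ord_max in
  let d' := N 0 ord_max + - s * N 1 ord_max in
  [/\ d != 0, d' != 0,
     N 0 0 - N 1 1 + 2 * s * N 0 1 = 2 * (F 0 0 + s * F 0 1) * d
   & N 0 0 - N 1 1 + 2 * - s * N 0 1 = 2 * (F 0 0 + - s * F 0 1) * d'].
Proof.
move=> pM [tF tF'] N d d'.
have eF := focus_line s2 pM e0 e1 tF; have eF' := focus_line s'2 pM e'0 e'1 tF'.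
have dn := focus_finite s2 pM eF; have dn' := focus_finite s'2 pM eF'.
by split.
Qed.

(** Each focus equation has degree one in one isotropic coordinate, with nonzero leading
    coefficient. This identifies a given focus with the one supplied by [is_axis]. *)
Lemma focal_unique M F G : parabola M -> focal M F -> focal M G ->
  zc F = zc G /\ zc' F = zc' G.
Proof.
move=> pM /(focal_eqs pM) [d0 d'0 eF eF'] /(focal_eqs pM) [_ _ eG eG'].
split.
  by apply: (eq_lincomb2 (-1) 1 (mulf_neq0 two0 d0) eF eG);
    rewrite /zc /isotropic_coord; ring.
by apply: (eq_lincomb2 (-1) 1 (mulf_neq0 two0 d'0) eF' eG');
  rewrite /zc' /isotropic_coord; ring.
Qed.

Lemma exparabola_focus M F : exparabola A B C M -> focal M F ->
  let N := invmx M in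
  let d := N 0 ord_max + s * N 1 ord_max in
  let d' := N 0 ord_max + - s * N 1 ord_max in
  let h := N 0 0 + N 1 1 - d * (O 0 0 - s * O 0 1) - d' * (O 0 0 + s * O 0 1) in
  [/\ rho * d * zc F = - d' * m, zc F * zc' F = rho
    & h * m = d' * (zc A + zc B + zc C) * m
        + d * rho * (zc A * zc B + zc B * zc C + zc C * zc A)].
Proof.
move=> [pM tBC tCA tAB] fF N d d' h.
have [d0 d'0 eF eF'] := focal_eqs pM fF.
have z0 P : zc P * zc' P = rho -> zc P != 0.
  by move=> eP; apply: contraNneq rho0 => z0; rewrite -eP z0 mul0r.
apply: tangent_sides_focus rho0 (z0 A circA) (z0 B circB) (z0 C circC) AB BC CA d0 d'0 _ _ _.
- exact (side_equation s2 two0 pM tBC eF eF' rho0 circB circC BC).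
- exact (side_equation s2 two0 pM tCA eF eF' rho0 circC circA CA).
- exact (side_equation s2 two0 pM tAB eF eF' rho0 circA circB AB).
Qed.

(** The coordinate z of the focus fixes z' = rho / z, the ratio d : d', and then h relative to d; so
    it fixes the dual matrix up to a factor. *)
Lemma exparabola_focus_inj M1 M2 F1 F2 :
  exparabola A B C M1 -> exparabola A B C M2 -> focal M1 F1 -> focal M2 F2 ->
  zc F1 = zc F2 -> same_conic M1 M2.
Proof.
move=> x1 x2 f1 f2 eF; have [p1 _ _ _] := x1; have [p2 _ _ _] := x2.
have [d1n d1'n a1 a1'] := focal_eqs p1 f1; have [d2n d2'n a2 a2'] := focal_eqs p2 f2.
have [b1 c1 h1] := exparabola_focus x1 f1; have [b2 c2 h2] := exparabola_focus x2 f2.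
rewrite eF in b1 c1.
have z0 : zc F2 != 0 by apply: contraNneq rho0 => z0; rewrite -c2 z0 mul0r.
have eF' : zc' F1 = zc' F2 by apply: (mulfI z0); rewrite c1 c2.
have m0 : m != 0.
  apply: contraNneq (mulf_neq0 (mulf_neq0 rho0 d2n) z0) => m0.
  by rewrite b2 m0 mulr0.
have uF : F1 0 0 + s * F1 0 1 = F2 0 0 + s * F2 0 1.
  by apply: (eq_lincomb1 1 (oner_neq0 K) eF); rewrite /zc /isotropic_coord; ring.
have uF' : F1 0 0 + - s * F1 0 1 = F2 0 0 + - s * F2 0 1.
  by apply: (eq_lincomb1 1 (oner_neq0 K) eF'); rewrite /zc' /isotropic_coord; ring.
rewrite uF in a1; rewrite uF' in a1'.
set N1 := invmx M1 in a1 a1' b1 h1 d1n d1'n *.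
set N2 := invmx M2 in a2 a2' b2 h2 d2n d2'n *.
set d1 := N1 0 ord_max + s * _ in a1 b1 h1 d1n.
set d1' := N1 0 ord_max + - s * _ in a1' b1 h1 d1'n.
set d2 := N2 0 ord_max + s * _ in a2 b2 h2 d2n.
set d2' := N2 0 ord_max + - s * _ in a2' b2 h2 d2'n.
pose k := d1 / d2.
have ek : d1 = k * d2 by rewrite divfK.
have ek' : d1' = k * d2'.
  by apply: (eq_lincomb3 1 (- k) (- rho * zc F2) m0 b1 b2 ek); ring.
have eh : N1 0 0 + N1 1 1 = k * (N2 0 0 + N2 1 1).
  rewrite ek ek' in h1.
  by apply: (eq_lincomb2 1 (- k) m0 h1 h2); ring.
have aE : N1 0 0 - N1 1 1 + 2 * s * N1 0 1 = k * (N2 0 0 - N2 1 1 + 2 * s * N2 0 1).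
  by rewrite a1 a2 ek; ring.
have aE' : N1 0 0 - N1 1 1 + 2 * - s * N1 0 1 = k * (N2 0 0 - N2 1 1 + 2 * - s * N2 0 1).
  by rewrite a1' a2' ek'; ring.
have four0 := mulf_neq0 two0 two0; have s20 := mulf_neq0 two0 s0.
have k0 : k != 0 by rewrite mulf_neq0 ?invr_eq0.
(* The five entries solve a linear system in [d], [d'], [h] and the two focus combinations,
   invertible since 2 and [s] are nonzero. *)
apply: (same_conic_dual p1 p2 k0).
- by apply: (eq_lincomb3 1 1 2 four0 aE aE' eh); ring.
- by apply: (eq_lincomb2 1 (-1) (mulf_neq0 four0 s0) aE aE'); ring.
- by apply: (eq_lincomb3 (-1) (-1) 2 four0 aE aE' eh); ring.
- by apply: (eq_lincomb2 1 1 two0 ek ek'); rewrite /d1 /d1' /d2 /d2'; ring.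
- by apply: (eq_lincomb2 1 (-1) s20 ek ek'); rewrite /d1 /d1' /d2 /d2'; ring.
Qed.

Lemma exparabola_axis M F G d l X : exparabola A B C M -> focal M F ->
  focal M G -> d != 0 -> on_conic M (infinite_pt d) ->
  line_through (affine_pt G) (infinite_pt d) l -> incident (affine_pt X) l ->
  rho * zc F ^+ 3 + - rho * zc X * zc F ^+ 2 + - m * zc' X * zc F + m * rho = 0.
Proof.
move=> xM fF fG d0 dM Gl Xl; have [pM _ _ _] := xM.
have [_ d'n _ _] := focal_eqs pM fF; have [zE zz _] := exparabola_focus xM fF.
apply: (axis_cubic d'n zE zz).
have [-> ->] := focal_unique pM fF fG.
(* Passing to isotropic coordinates multiplies the parallelism determinant by -2s. *)
apply: (eq_lincomb1 (- 2 * s) (oner_neq0 K) (axis_direction pM d0 dM Gl Xl)).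
by rewrite /zc /zc' /isotropic_coord; ring.
Qed.

(** * The focal triangle and its orthocenter *)

Lemma cocyclic_triangle P Q S :
  zc P * zc' P = rho -> zc Q * zc' Q = rho -> zc S * zc' S = rho ->
  zc P != zc Q -> zc Q != zc S -> zc S != zc P -> is_triangle P Q S.
Proof.
move=> cP cQ cS PQ QS SP [l [[l0 lP lQ] lS]]; case/eqP: l0.
pose p := l 0 0 - s * l 1 0; pose q := l 0 0 + s * l 1 0.
pose r := 2 * (l ord_max 0 + l 0 0 * O 0 0 + l 1 0 * O 0 1).
(* On the circle z' = rho / z, so the equation of a line becomes quadratic in z; three distinct
   roots make it vanish identically. *)
have quad T : zc T * zc' T = rho -> incident (affine_pt T) l ->
    0 * zc T ^+ 3 + p * zc T ^+ 2 + r * zc T + rho * q = 0.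
  move=> cT /(isotropic_line O s2) hT.
  by apply: (eq_lincomb2 (zc T) (- q) (oner_neq0 K) hT cT); rewrite /p /q /r /zc /zc'; ring.
have [p0 r0 q0] := cubic_vieta PQ QS SP (quad P cP lP) (quad Q cQ lQ) (quad S cS lS).
apply: (isotropic_line_eq0 (O := O) s2 two0); rewrite -/p -/q -/r.
- by rewrite p0 oppr0 mul0r.
- by apply: (mulfI rho0); rewrite q0 oppr0 mul0r mulr0.
- by rewrite r0 mul0r.
Qed.

Lemma on_altitude_isotropic P Q S H :
  (zc H - zc P) * (zc' Q - zc' S) + (zc' H - zc' P) * (zc Q - zc S) = 0 ->
  on_altitude P Q S H.
Proof.
move=> h; apply: (orthogonal_isotropic s2 two0); rewrite !mxE.
by apply: (eq_lincomb1 1 (oner_neq0 K) h); rewrite /zc /zc' /isotropic_coord; ring.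
Qed.

Lemma focal_triangle_orthocenter M1 M2 M3 F1 F2 F3 X :
  let axis M X := exists G d l, [/\ focal M G, d != 0,
    on_conic M (infinite_pt d), line_through (affine_pt G) (infinite_pt d) l
    & incident (affine_pt X) l] in
  [/\ exparabola A B C M1, exparabola A B C M2 & exparabola A B C M3] ->
  [/\ axis M1 X, axis M2 X & axis M3 X] ->
  [/\ ~ same_conic M1 M2, ~ same_conic M2 M3 & ~ same_conic M3 M1] ->
  [/\ focal M1 F1, focal M2 F2 & focal M3 F3] ->
  is_triangle F1 F2 F3 /\ is_orthocenter F1 F2 F3 X.
Proof.
move=> axis [x1 x2 x3] [a1 a2 a3] [d12 d23 d31] [f1 f2 f3].
have cubic M F : exparabola A B C M -> axis M X -> focal M F ->
    rho * zc F ^+ 3 + - rho * zc X * zc F ^+ 2 + - m * zc' X * zc F + m * rho = 0.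
  move=> xM [G [d [l [fG dn dM Gl Xl]]]] fF.
  exact: exparabola_axis xM fF fG dn dM Gl Xl.
have n12 : zc F1 != zc F2.
  by apply/eqP=> e12; apply/d12/(exparabola_focus_inj x1 x2 f1 f2 e12).
have n23 : zc F2 != zc F3.
  by apply/eqP=> e23; apply/d23/(exparabola_focus_inj x2 x3 f2 f3 e23).
have n31 : zc F3 != zc F1.
  by apply/eqP=> e31; apply/d31/(exparabola_focus_inj x3 x1 f3 f1 e31).
have [_ c1 _] := exparabola_focus x1 f1; have [_ c2 _] := exparabola_focus x2 f2.
have [_ c3 _] := exparabola_focus x3 f3.
split; first exact: cocyclic_triangle.
have [v2 v1 v0] := cubic_vieta n12 n23 n31 (cubic _ _ x1 a1 f1) (cubic _ _ x2 a2 f2)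
  (cubic _ _ x3 a3 f3).
have xE : zc X = zc F1 + zc F2 + zc F3.
  by apply: (eq_lincomb1 (-1) rho0 v2); ring.
have mE : m = - (zc F1 * zc F2 * zc F3).
  by apply: (eq_lincomb1 1 rho0 v0); ring.
have z0 P : zc P * zc' P = rho -> zc P != 0.
  by move=> eP; apply: contraNneq rho0 => zP; rewrite -eP zP mul0r.
have p0 : zc F1 * zc F2 * zc F3 != 0 by rewrite !mulf_neq0 ?z0.
have inv P : zc P * zc' P = rho -> zc' P = rho / zc P.
  by move=> eP; apply: (mulfI (z0 P eP)); rewrite eP mulrC divfK ?z0.
(* The linear coefficient gives x' = rho (z1 z2 + z2 z3 + z3 z1) / (z1 z2 z3), and rho / z = z' at
   each focus. *)
have x'E : zc' X = zc' F1 + zc' F2 + zc' F3.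
  by apply: (eq_lincomb2 1 (zc' X) p0 v1 mE); ring: c1 c2 c3.
(* For instance (z2 + z3)(z2' - z3') + (z2' + z3')(z2 - z3) = 2 (z2 z2' - z3 z3') = 0. *)
split; apply: on_altitude_isotropic; rewrite xE x'E.
- by rewrite (inv _ c1) (inv _ c2) (inv _ c3); field; rewrite !z0.
- by rewrite (inv _ c1) (inv _ c2) (inv _ c3); field; rewrite !z0.
- by rewrite (inv _ c1) (inv _ c2) (inv _ c3); field; rewrite !z0.
Qed.

End Exparabola.

(** * The circumcentre, and the passage from real to complex coordinates *)

Lemma collinear_det0 P Q S :
  (Q 0 0 - P 0 0) * (S 0 1 - P 0 1) = (Q 0 1 - P 0 1) * (S 0 0 - P 0 0) ->
  collinear P Q S.
Proof.
move=> det0.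
have line u v : (u != 0) || (v != 0) ->
    (Q 0 0 - P 0 0) * v = (Q 0 1 - P 0 1) * u ->
    (S 0 0 - P 0 0) * v = (S 0 1 - P 0 1) * u -> collinear P Q S.
  move=> uv eQ eS.
  pose l : 'cV[K]_3 := \col_j if j == 0 then v else
    if j == 1 then - u else u * P 0 1 - v * P 0 0.
  exists l; split; first split.
  - apply: contraTneq uv => l0.
    have := congr1 (fun l' : 'cV[K]_3 => l' 0 0) l0; rewrite !mxE /= => ->.
    have := congr1 (fun l' : 'cV[K]_3 => l' 1 0) l0; rewrite !mxE /=.
    by move/eqP; rewrite oppr_eq0 => ->; rewrite eqxx.
  - by apply/incident_affine; rewrite !mxE /=; ring.
  - by apply/incident_affine; rewrite !mxE /=; apply: (eq_lincomb1 1 (oner_neq0 K) eQ); ring.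
  - by apply/incident_affine; rewrite !mxE /=; apply: (eq_lincomb1 1 (oner_neq0 K) eS); ring.
(* The line takes the direction Q - P, or S - P if Q = P, or (1, 0) if all three points coincide. *)
have [Q0|] := boolP ((Q 0 0 - P 0 0 != 0) || (Q 0 1 - P 0 1 != 0)).
  by apply: (line _ _ Q0); [ring | apply: (eq_lincomb1 (-1) (oner_neq0 K) det0); ring].
rewrite negb_or !negbK => /andP[/eqP q0 /eqP q1].
have [S0|] := boolP ((S 0 0 - P 0 0 != 0) || (S 0 1 - P 0 1 != 0)).
  by apply: (line _ _ S0); rewrite ?q0 ?q1; ring.
rewrite negb_or !negbK => /andP[/eqP r0 /eqP r1].
by apply: (line 1 0); rewrite ?oner_neq0 // ?q1 ?r1; ring.
Qed.

End Coordinates.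

Lemma circumcenter (R : realFieldType) (A B C : 'rV[R]_2) : is_triangle A B C ->
  let sqdist (P O : 'rV[R]_2) := (P 0 0 - O 0 0) ^+ 2 + (P 0 1 - O 0 1) ^+ 2 in
  exists (O : 'rV[R]_2) (rho : R),
    [/\ rho != 0, sqdist A O = rho, sqdist B O = rho & sqdist C O = rho].
Proof.
move=> tABC sqdist.
pose u0 := B 0 0 - A 0 0; pose u1 := B 0 1 - A 0 1.
pose v0 := C 0 0 - A 0 0; pose v1 := C 0 1 - A 0 1.
have D0 : u0 * v1 - u1 * v0 != 0.
  by rewrite subr_eq0; apply/eqP=> /collinear_det0.
(* Cramer's rule for the perpendicular bisectors of AB and AC, with origin at A. *)
pose o0 := A 0 0 + (v1 * (u0 ^+ 2 + u1 ^+ 2) - u1 * (v0 ^+ 2 + v1 ^+ 2)) /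
  (2 * (u0 * v1 - u1 * v0)).
pose o1 := A 0 1 + (u0 * (v0 ^+ 2 + v1 ^+ 2) - v0 * (u0 ^+ 2 + u1 ^+ 2)) /
  (2 * (u0 * v1 - u1 * v0)).
pose O : 'rV[R]_2 := \row_j if j == 0 then o0 else o1.
have O0 : O 0 0 = o0 by rewrite mxE.
have O1 : O 0 1 = o1 by rewrite mxE.
have BA : sqdist B O = sqdist A O.
  rewrite /sqdist O0 O1 /o0 /o1 -[B 0 0](subrK (A 0 0)) -[B 0 1](subrK (A 0 1)) -/u0 -/u1.
  by field; rewrite D0.
have CA : sqdist C O = sqdist A O.
  rewrite /sqdist O0 O1 /o0 /o1 -[C 0 0](subrK (A 0 0)) -[C 0 1](subrK (A 0 1)) -/v0 -/v1.
  by field; rewrite D0.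
exists O, (sqdist A O); split=> //.
(* Over an ordered field a zero squared radius would put all three vertices at [O]. *)
apply: contraNneq D0 => rho0.
have on_center P : sqdist P O = 0 -> P 0 0 = O 0 0 /\ P 0 1 = O 0 1.
  move/eqP; rewrite paddr_eq0 ?sqr_ge0 // !sqrf_eq0 !subr_eq0.
  by case/andP=> /eqP -> /eqP ->.
have [a0 a1] := on_center A rho0.
have [b0 b1] := on_center B (etrans BA rho0).
by rewrite /u0 /u1 b0 b1 a0 a1 !subrr !mul0r subr0.
Qed.

Lemma isotropic_dirE (R : rcfType) (s : R[i]) :
  isotropic_dir s 0 0 = 1 /\ isotropic_dir s 0 1 = s.
Proof. by rewrite !mxE. Qed.

Lemma to_complex_circle (R : rcfType) (O P : 'rV[R]_2) :
  isotropic_coord 'i%C (to_complex O) (to_complex P)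
    * isotropic_coord (- 'i%C) (to_complex O) (to_complex P)
  = ((P 0 0 - O 0 0) ^+ 2 + (P 0 1 - O 0 1) ^+ 2)%:C%C.
Proof.
have i2 : 'i%C ^+ 2 = -1 :> R[i] by exact: sqr_i.
by rewrite /isotropic_coord !mxE !rmorphD !rmorphXn !rmorphB /=; ring: i2.
Qed.

(** For real points the real and imaginary parts of z are the coordinates relative to [O], so
    distinct vertices have distinct z. *)
Lemma to_complex_isotropic_inj (R : rcfType) (O P Q : 'rV[R]_2) :
  isotropic_coord 'i%C (to_complex O) (to_complex P)
    = isotropic_coord 'i%C (to_complex O) (to_complex Q) -> P = Q.
Proof.
rewrite /isotropic_coord !mxE => /eqP; rewrite eq_complex; simpc => /=.
rewrite !(inj_eq (addIr _)) => /andP[/eqP h0 /eqP h1].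
apply/matrixP=> i j; rewrite ord1.
by case: j => [[|[|//]] hj];
  [rewrite (_ : Ordinal hj = 0) | rewrite (_ : Ordinal hj = 1)]; rewrite //;
  apply: val_inj.
Qed.

Theorem theorem3 (R : realType) (A B C X : 'rV[R]_2) (F1 F2 F3 : 'rV[R[i]]_2)
    (hABC : is_triangle A B C)
    (hF : X_focal_triangle A B C X F1 F2 F3) :
  is_triangle F1 F2 F3 /\ is_orthocenter F1 F2 F3 (to_complex X).
Proof.
have [O [rho [rho0 cA cB cC]]] := circumcenter hABC.
have i2 : 'i%C ^+ 2 = -1 :> R[i] by exact: sqr_i.
have [e0 e1] := isotropic_dirE ('i%C : R[i]).
have [e'0 e'1] := isotropic_dirE (- 'i%C : R[i]).
have two0 : 2 != 0 :> R[i] by rewrite pnatr_eq0.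
have rho0' : rho%:C%C != 0 :> R[i] by rewrite fmorph_eq0.
have AB : A != B by apply/eqP=> AB; apply: hABC; apply: collinear_det0; rewrite AB; ring.
have BC : B != C by apply/eqP=> BC; apply: hABC; apply: collinear_det0; rewrite BC; ring.
have CA : C != A by apply/eqP=> CA; apply: hABC; apply: collinear_det0; rewrite CA; ring.
have ne (P Q : 'rV[R]_2) : P != Q -> isotropic_coord 'i%C (to_complex O) (to_complex P)
    != isotropic_coord 'i%C (to_complex O) (to_complex Q).
  by apply: contra_neq; exact: to_complex_isotropic_inj.
have circ (P : 'rV[R]_2) : (P 0 0 - O 0 0) ^+ 2 + (P 0 1 - O 0 1) ^+ 2 = rho ->
    isotropic_coord 'i%C (to_complex O) (to_complex P)
      * isotropic_coord (- 'i%C) (to_complex O) (to_complex P) = rho%:C%C.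
  by move=> <-; exact: to_complex_circle.
have [M1 [M2 [M3 [[x1 a1] [x2 a2] [x3 a3] [dist foc]]]]] := hF.
have axis (M : 'M[R[i]]_3) : axis_incident M (to_complex X) -> exists G d l,
    [/\ focal (isotropic_dir 'i%C) (isotropic_dir (- 'i%C)) M G, d != 0,
        on_conic M (infinite_pt d), line_through (affine_pt G) (infinite_pt d) l
      & incident (affine_pt (to_complex X)) l].
  by case=> l [G [d [fG d0 dM Gl]]] Xl; exists G, d, l.
exact: (focal_triangle_orthocenter i2 two0 rho0' e0 e1 e'0 e'1 (circ A cA) (circ B cB)
  (circ C cC) (ne A B AB) (ne B C BC) (ne C A CA) (And3 x1 x2 x3)
  (And3 (axis M1 a1) (axis M2 a2) (axis M3 a3)) dist foc).
Qed.
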